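(* Let $P$ be a (naturally labeled) rooted tree on $n$ elements. Then $$\mathcal{G}_{\mathrm{Ldes}}(P,z) \;=\; A^{(2)}_n(z).$$
   Context: All posets are finite. A poset $P$ is a rooted tree if it has a unique minimal element and its Hasse diagram is a tree. For a poset $(P,\preceq)$, $a \lessdot b$ denotes a cover relation, and $\check{P} = P \cup \{\hat 0\}$ is $P$ with a new minimum $\hat 0$ adjoined (even if $P$ already has a minimum). $P$ is naturally labeled if its ground set is $\{1,\dots,n\}$, $n = |P|$, and $a \prec b$ implies $a < b$ as integers; one sets $\hat 0 := 0$. For $\tau \in \mathfrak{S}_n$ set $\tau(0) := 0$. For a saturated chain $C = \{\hat 0 = c_1 \lessdot \cdots \lessdot c_k = a\}$ in $\check{P}$ let $\mathrm{des}(\tau|_C)$ be the number of $1 \le j < k$ with $\tau(c_j) > \tau(c_{j+1})$. The permutation $\tau$ is descent-compatible with $P$ if for every $a \in P$ the number $\mathrm{des}(\tau|_C)$ is the same for all saturated chains $C$ in $\check{P}$ from $\hat 0$ to $a$; then $\mathrm{des}_{P,\tau}(a)$ denotes this common number, and $\mathrm{des}_{P,\tau}(\hat 0) := 0$. $\mathrm{DC}(P) \subseteq \mathfrak{S}_n$ is the set of descent-compatible permutations. For $\tau \in \mathrm{DC}(P)$, $\mathrm{Ldes}_P(\tau)$ is the number of pairs $(a,b) \in \check{P} \times \check{P}$ with $\tau(a) = \tau(b) - 1$ such that either $\mathrm{des}_{P,\tau}(a) < \mathrm{des}_{P,\tau}(b)$, or $\mathrm{des}_{P,\tau}(a) = \mathrm{des}_{P,\tau}(b)$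 and $a > b$ (as integers). Define $\mathcal{G}_{\mathrm{Ldes}}(P,z) = \sum_{\tau \in \mathrm{DC}(P)} z^{\mathrm{Ldes}_P(\tau)}$. A big ascent of $\tau \in \mathfrak{S}_n$ is an index $0 \le i < n$ with $\tau(i+1) - \tau(i) \ge 2$ (where $\tau(0)=0$); $\mathrm{asc}^{(2)}(\tau)$ is the number of big ascents, and $A^{(2)}_n(z) = \sum_{\tau \in \mathfrak{S}_n} z^{\mathrm{asc}^{(2)}(\tau)}$. *)

(* Defs.v *)
From HB Require Import structures.
From mathcomp Require Import all_boot all_order all_fingroup all_algebra.
Set Implicit Arguments.
Unset Strict Implicit.
Unset Printing Implicit Defensive.
Import GRing.Theory.

(* A labeled poset P on {1, ..., n} is a relation on 'I_n, where i : 'I_n      *)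
(* stands for the label i + 1. The ground set of P with a new minimum 0 is     *)
(* 'I_n.+1, with every element standing for itself: ord0 is the new minimum    *)
(* and lift ord0 i, whose value is i.+1, is the element i of P.                *)

Section Posets.
Variables (T : finType) (r : rel T).

Definition partial_order : Prop :=
  [/\ reflexive r, antisymmetric r & transitive r].

Definition strict : rel T := [rel x y | (x != y) && r x y].

Definition cover : rel T :=
  [rel x y | strict x y && ~~ [exists z, strict x z && strict z y]].

Definition hasse : rel T := [rel x y | cover x y || cover y x].

Definition minimal (x : T) : Prop := forall y, ~~ strict y x.

End Posets.

(* A tree is a connected acyclic simple graph; cycles have length at least 3.  *)
Definition is_tree (T : finType) (e : rel T) : Prop :=
  (forall x y, connect e x y) /\
  (forall c : seq T, 2 < size c -> ~ ucycle e c).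

Definition rooted_tree (T : finType) (r : rel T) : Prop :=
  (exists! x, minimal r x) /\ is_tree (hasse r).

Definition naturally_labeled n (r : rel 'I_n) : Prop :=
  forall a b, strict r a b -> a < b.

Definition adjoin_min n (r : rel 'I_n) : rel 'I_n.+1 :=
  [rel x y | match unlift ord0 x, unlift ord0 y with
             | None, _ => true
             | Some _, None => false
             | Some a, Some b => r a b
             end].

(* t extended by t(0) = 0: ext t (lift ord0 i) = lift ord0 (t i).              *)
Definition ext n (t : 'S_n) : 'S_n.+1 := lift_perm ord0 ord0 t.

(* The saturated chain from the new minimum to a whose elements are ord0 :: p. *)
Definition sat_chain n (r : rel 'I_n) (a : 'I_n.+1) (p : seq 'I_n.+1) : bool :=
  path (cover (adjoin_min r)) ord0 p && (last ord0 p == a).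

Definition chain_des n (t : 'S_n) (p : seq 'I_n.+1) : nat :=
  count (fun xy => ext t xy.2 < ext t xy.1) (zip (ord0 :: p) p).

(* Below, chains range over the finite type n.-bseq 'I_n.+1 of sequences of    *)
(* size at most n; this lemma shows that no saturated chain is left out.       *)
Lemma sat_chain_size n (r : rel 'I_n) a p :
  naturally_labeled r -> sat_chain r a p -> size p <= n.
Proof.
move=> nat_r /andP[cov_p _].
have lt_cov : subrel (cover (adjoin_min r)) (relpre (@nat_of_ord n.+1) ltn).
  move=> x y /andP[/andP[neq_xy]]; move: neq_xy => /=.
  case: (unliftP ord0 x) => [i ->|->]; case: (unliftP ord0 y) => [j ->|->] //.
    rewrite (inj_eq lift_inj) /adjoin_min /= !liftK => neq_ij r_ij _.
    by rewrite /= /bump !add1n !ltnS; apply: nat_r; rewrite /strict /= neq_ij.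
  by rewrite /adjoin_min /= liftK unlift_none.
have lt_p := sub_path lt_cov cov_p.
have : uniq (ord0 :: p).
  apply: (@sorted_uniq _ (relpre (@nat_of_ord n.+1) ltn)) => //.
  - by move=> y x z; apply: ltn_trans.
  - by move=> x /=; apply: ltnn.
move/card_uniqP=> /= size_p; rewrite -ltnS -size_p.
by rewrite -[n.+1 in leqRHS]card_ord max_card.
Qed.

Definition descent_compatible n (r : rel 'I_n) (t : 'S_n) : bool :=
  [forall a : 'I_n, forall p : n.-bseq 'I_n.+1, forall q : n.-bseq 'I_n.+1,
    sat_chain r (lift ord0 a) p && sat_chain r (lift ord0 a) q
      ==> (chain_des t p == chain_des t q)].

Definition DC n (r : rel 'I_n) : {set 'S_n} :=
  [set t | descent_compatible r t].

(* The value on an arbitrary saturated chain to a, hence the common value when *)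
(* t is descent-compatible. The only chain to ord0 is [::], with value 0.      *)
Definition desP n (r : rel 'I_n) (t : 'S_n) (a : 'I_n.+1) : nat :=
  if [pick p : n.-bseq 'I_n.+1 | sat_chain r a p] is Some p
  then chain_des t p else 0.

Definition Ldes n (r : rel 'I_n) (t : 'S_n) : nat :=
  #|[set ab : 'I_n.+1 * 'I_n.+1 |
      ((ext t ab.1).+1 == ext t ab.2 :> nat) &&
      ((desP r t ab.1 < desP r t ab.2) ||
       (desP r t ab.1 == desP r t ab.2) && (ab.2 < ab.1))]|.

Definition big_asc n (t : 'S_n) : nat :=
  #|[set i : 'I_n | ext t (widen_ord (leqnSn n) i) + 2 <= ext t (lift ord0 i)]|.

Local Open Scope ring_scope.

Definition G_Ldes n (r : rel 'I_n) : {poly int} :=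
  \sum_(t in DC r) 'X^(Ldes r t).

Definition A2 n : {poly int} := \sum_(t : 'S_n) 'X^(big_asc t).

(* Main.v *)
(* Read tau^-1 as a word 0 s_1 ... s_n. In a rooted tree every element has at  *)
(* most one lower cover, so every permutation is descent-compatible, and Ldes  *)
(* counts the adjacent letters a, b with (des a, - a) < (des b, - b)           *)
(* lexicographically. The largest label n + 1 is a leaf; inserting it into a   *)
(* word of length n leaves the other des unchanged, adds 0 or 1 to Ldes, and   *)
(* of the n + 1 places exactly Ldes + 1 add 0. Inserting n + 1 in a word       *)
(* changes the number of big ascents in the same way, so both polynomials      *)
(* satisfy the recursion of the Eulerian polynomials.                          *)
Require Import Defs.
From mathcomp Require Import all_boot all_order all_fingroup all_algebra.
From mathcomp Require Import zify ring.
Set Implicit Arguments.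
Unset Strict Implicit.
Unset Printing Implicit Defensive.
Import Defs GRing.Theory.

(** Both statistics can be read off a word [0 :: s], and each satisfies [eulerian_stat]: of the
    slots for the new largest letter, the number that raise the statistic is n minus its current
    value. This alone fixes the distribution ([sum_eulerian_stat]), so the two polynomials agree
    without any explicit bijection. For big ascents ([big_asc_eulerian]), the slot right after n is
    the only one where n + 1 creates no big ascent. For Ldes ([Ldes_eulerian]), the key (des, -
    label) of n + 1 depends on the slot only through the side of the parent on which it lies, so the
    count of ascents around n + 1 telescopes. The tree hypothesis enters through
    [adjoin_min_lower_cover_inj]: unique lower covers give a parent function, des becomes a
    recursion along ancestors, and [Ldes_word] moves Ldes to words. *)

Section Insertion.
Variable T : Type.
Implicit Types (s : seq T) (m x : T) (R : rel T).

Definition insert m s j := take j s ++ m :: drop j s.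

Definition ascents R x s := count id (pairmap R x s).

Lemma last_take_nth x s j : j <= size s -> last x (take j s) = nth x (x :: s) j.
Proof.
elim: s x j => [|y s IHs] x [|j] //= le_j.
by rewrite (IHs y) //; apply: set_nth_default.
Qed.

Lemma ascentsE R x s :
  ascents R x s = \sum_(j < size s) R (nth x (x :: s) j) (nth x s j).
Proof.
rewrite /ascents -sum1_count big_mkcond (big_nth false) size_pairmap big_mkord.
by apply: eq_bigr => j _; rewrite (nth_pairmap x) //=; case: R.
Qed.

(** One adjacent pair is broken and two are created, or only one created when [j = size s]. The
    broken pair stands on the left to avoid truncated subtraction. *)
Lemma ascents_insert R x m s j : j <= size s ->
  ascents R x (insert m s j) + (j < size s) * R (nth x (x :: s) j) (nth x s j) =
  ascents R x s + R (nth x (x :: s) j) m + (j < size s) * R m (nth x s j).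
Proof.
move=> le_j; rewrite /ascents /insert.
rewrite -[in pairmap R x s](cat_take_drop j s) !pairmap_cat !count_cat /=.
rewrite !last_take_nth //; have [lt_j|ge_j] := ltnP j (size s).
  by rewrite (drop_nth x lt_j) /=; lia.
by rewrite drop_oversize //=; lia.
Qed.

End Insertion.

Lemma eq_in_ascents (T : eqType) (R R' : rel T) x s :
  {in x :: s &, R =2 R'} -> ascents R x s = ascents R' x s.
Proof.
move=> eqR; rewrite !ascentsE; apply: eq_bigr => j _.
by rewrite eqR // ?mem_nth // ?inE ?mem_nth ?orbT //= ltnS ltnW.
Qed.

(** * Permutations as words, and insertion of the largest letter *)

Section Words.
Variable n : nat.
Implicit Type t : 'S_n.

(* The values of t on 1, ..., n, hence without the leading t(0) = 0.           *)
Definition word t : seq nat := [seq (t i).+1 | i <- enum 'I_n].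

Lemma size_word t : size (word t) = n.
Proof. by rewrite size_map size_enum_ord. Qed.

Lemma nth_word t (i : 'I_n) : nth 0 (word t) i = (t i).+1.
Proof. by rewrite (nth_map i) ?size_enum_ord // nth_ord_enum. Qed.

Lemma word_ext t : 0 :: word t = [seq val (ext t i) | i <- enum 'I_n.+1].
Proof.
rewrite enum_ordSl /= /ext lift_perm_id -map_comp; congr (_ :: _).
by apply: eq_map => i /=; rewrite lift_perm_lift.
Qed.

Lemma nth_word_ext t (i : 'I_n.+1) : nth 0 (0 :: word t) i = ext t i.
Proof. by rewrite word_ext (nth_map ord0) ?size_enum_ord // nth_ord_enum. Qed.

Lemma uniq_word_ext t : uniq (0 :: word t).
Proof.
rewrite word_ext map_inj_uniq ?enum_uniq //.
by move=> i j /val_inj/perm_inj.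
Qed.

Lemma perm_word t : perm_eq (word t) (iota 1 n).
Proof.
apply: uniq_perm; rewrite ?iota_uniq //.
  by have /andP[] := uniq_word_ext t.
move=> a; rewrite mem_iota add1n ltnS.
apply/mapP/idP => [[i _ ->]|]; first by rewrite ltnS leq0n ltn_ord.
case: a => // a /= lt_a; exists ((t^-1)%g (Ordinal lt_a)); first by rewrite mem_enum.
by rewrite permKV.
Qed.

Lemma index_word_ext t (a : 'I_n.+1) : index (a : nat) (0 :: word t) = ext t^-1 a.
Proof.
have <- : nth 0 (0 :: word t) (ext t^-1 a) = a :> nat.
  by rewrite nth_word_ext /ext -lift_permV permKV.
by rewrite index_uniq ?uniq_word_ext //= size_word.
Qed.

End Words.

Lemma word_lift_max n (t : 'S_n) (j : 'I_n.+1) :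
  word (lift_perm j ord_max t) = insert n.+1 (word t) j.
Proof.
have le_j : j <= n by rewrite -ltnS.
apply: (@eq_from_nth _ 0) => [|i].
  by rewrite size_cat /= size_takel ?size_drop ?size_word //; lia.
rewrite size_word => lt_i; pose k := Ordinal lt_i.
rewrite -[i]/(val k) nth_word /insert nth_cat size_takel ?size_word //.
case: (unliftP j k) => [l ->|->].
  rewrite lift_perm_lift lift_max /= /bump; have [le_jl|lt_lj] := leqP j l.
    rewrite ltnNge ltnW ?ltnS //= add1n subSn //= nth_drop subnKC //.
    by rewrite nth_word.
  by rewrite add0n lt_lj nth_take // nth_word.
by rewrite lift_perm_id ltnn subnn.
Qed.

Lemma lift_max_bij n :
  bijective (fun u : 'I_n.+1 * 'S_n => lift_perm u.1 ord_max u.2).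
Proof.
(* Injectivity suffices, since (n + 1) n! = (n + 1)!. *)
apply: inj_card_bij => [[i s] [j t] /= eq_st|]; last first.
  by rewrite card_prod card_ord !card_Sn factS.
have eq_ij : i = j.
  by apply: (@perm_inj _ (lift_perm i ord_max s)); rewrite lift_perm_id eq_st lift_perm_id.
rewrite {i}eq_ij in eq_st *; congr (_, _); apply/permP => k.
by apply: (@lift_inj _ ord_max); rewrite -!(lift_perm_lift j) eq_st.
Qed.

Lemma sum_perm_insert (V : nmodType) n (F : seq nat -> V) :
  (\sum_(t : 'S_n.+1) F (word t) =
   \sum_(t : 'S_n) \sum_(j < n.+1) F (insert n.+1 (word t) j))%R.
Proof.
rewrite (reindex _ (onW_bij _ (lift_max_bij n))) exchange_big pair_bigA /=.
by apply: eq_bigr => u _; rewrite word_lift_max.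
Qed.

Lemma ascents_word n (t : 'S_n) (R : rel nat) :
  ascents R 0 (word t) =
  #|[set i : 'I_n | R (ext t (widen_ord (leqnSn n) i)) (ext t (lift ord0 i))]|.
Proof.
rewrite ascentsE size_word -sum1_card [RHS]big_mkcond /=.
apply: eq_bigr => i _; rewrite inE -!nth_word_ext /= add0n.
by case: R.
Qed.

Lemma big_ascE n (t : 'S_n) :
  big_asc t = ascents (fun a b => a + 2 <= b) 0 (word t).
Proof. by rewrite ascents_word. Qed.

(* Of the n.+1 places for n.+1, exactly n - L s raise L by 1 and the others    *)
(* keep it: the insertion recursion of the Eulerian numbers.                   *)
Definition eulerian_stat (L : seq nat -> nat) : Prop :=
  L [::] = 0 /\
  forall n s, perm_eq s (iota 1 n) -> exists d : nat -> bool,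
    (forall j, j <= n -> L (insert n.+1 s j) = L s + d j) /\
    \sum_(j < n.+1) d j + L s = n.

(** * The Eulerian recursion *)

Section Eulerian.
Local Open Scope ring_scope.

Fixpoint eulerian n : {poly int} :=
  if n is n'.+1 then
    (1 + n'%:R * 'X) * eulerian n' + ('X - 'X ^+ 2) * (eulerian n')^`()
  else 1.

(** A word with value k yields k + 1 words with value k and n - k with value k + 1, and (k + 1) X^k
    + (n - k) X^(k+1) = (1 + n X) X^k + (X - X^2) (X^k)'. *)
Lemma sum_eulerian_stat L n : eulerian_stat L ->
  \sum_(t : 'S_n) 'X^(L (word t)) = eulerian n.
Proof.
case=> L0 LS; elim: n => [|n IHn] /=.
  rewrite (eq_bigr (fun=> 1)) => [|t _].
    by rewrite sumr_const card_Sn.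
  by rewrite (size0nil (size_word t)) L0.
rewrite (sum_perm_insert n (fun s => 'X^(L s))) -IHn raddf_sum !big_distrr -big_split /=.
apply: eq_bigr => t _; have [d [Ld sum_d]] := LS _ _ (perm_word t).
rewrite (eq_bigr (fun j : 'I_n.+1 =>
    'X^(L (word t)) + (d j)%:R * ('X^((L (word t)).+1) - 'X^(L (word t))))); last first.
  move=> j _; rewrite (Ld _ (ltn_ord j)).
  by case: (d j); rewrite /= ?addn0 ?addn1; ring.
move: (L _) sum_d => k sum_d.
(* Replacing n by this sum leaves a subtraction-free substitution, after which the claim is a ring
   identity. *)
have nE : n%:R = (\sum_(j < n.+1) d j)%:R + k%:R :> {poly int}.
  by rewrite -natrD sum_d.
rewrite big_split /= sumr_const card_ord -big_distrl -natr_sum /=.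
rewrite -[_ *+ n.+1]mulr_natr -natr1 nE; move: (bigop _ _ _) => D.
rewrite derivXn -[X in X * (_ - _)]/(D%:R); move: (D%:R) => d'.
have -> : 'X^(k.+1) = 'X * 'X^k :> {poly int} by rewrite exprS.
have -> : ('X - 'X ^+ 2) * ('X^(k.-1) *+ k) = (1 - 'X) * 'X^k * k%:R :> {poly int}.
  case: k {sum_d nE} => [|k]; first by rewrite mulr0n !mulr0.
  rewrite -[in LHS]mulr_natr /= [in RHS]exprS; move: (k.+1%:R) => c.
  by set Y : {poly int} := 'X^k; move: Y c => Y c; ring.
set Y : {poly int} := 'X^k; set Z : {poly int} := 'X; set K : {poly int} := k%:R.
move: Y Z K d' => Y Z K d'; ring.
Qed.

End Eulerian.

(** * Big ascents under insertion *)

Lemma nth_perm_iota_le n s j : perm_eq s (iota 1 n) -> nth 0 (0 :: s) j <= n.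
Proof.
move=> perm_s; have [lt_j|ge_j] := ltnP j (size (0 :: s)); last by rewrite nth_default.
have := mem_nth 0 lt_j; rewrite inE (perm_mem perm_s) mem_iota add1n ltnS.
by case/predU1P => [->|/andP[]].
Qed.

Lemma uniq0_perm_iota n s : perm_eq s (iota 1 n) -> uniq (0 :: s).
Proof.
by move=> perm_s; rewrite /= (perm_uniq perm_s) (perm_mem perm_s) mem_iota iota_uniq.
Qed.

Lemma mem0_perm_iota n s a : perm_eq s (iota 1 n) -> (a \in 0 :: s) = (a <= n).
Proof.
move=> perm_s; rewrite inE (perm_mem perm_s) mem_iota add1n ltnS.
by case: a.
Qed.

Lemma index_perm_iota_le n s a :
  perm_eq s (iota 1 n) -> a <= n -> index a (0 :: s) <= n.
Proof.
move=> perm_s; rewrite -(mem0_perm_iota _ perm_s) -index_mem /= ltnS.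
by rewrite (perm_size perm_s) size_iota.
Qed.

Lemma big_asc_eulerian : eulerian_stat (ascents (fun a b => a + 2 <= b) 0).
Proof.
split=> // n s perm_s; have size_s : size s = n by rewrite (perm_size perm_s) size_iota.
set R := (fun a b : nat => _); set v := nth 0 (0 :: s).
have v_le j : v j <= n := nth_perm_iota_le j perm_s.
(* Inserting after [v j] creates a big ascent exactly when [v j != n]; the gain is lost when the
   broken pair was already one. The pair starting at n + 1 never counts. *)
exists (fun j => (v j != n) && ~~ ((j < n) && R (v j) (v j.+1))).
have dE j : ((v j != n) && ~~ ((j < n) && R (v j) (v j.+1))) + (j < n) * R (v j) (v j.+1)
    = (v j != n).
  by rewrite /R; have := v_le j; have := v_le j.+1; lia.
split=> [j le_j|].
  have := ascents_insert R 0 n.+1; move=> /(_ s j); rewrite size_s => /(_ le_j).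
  have := dE j; rewrite -[nth 0 s j]/(v j.+1) -/(v j).
  have -> : R (v j) n.+1 = (v j != n) by rewrite /R; have := v_le j; lia.
  have -> : R n.+1 (v j.+1) = false by rewrite /R; have := v_le j.+1; lia.
  lia.
have ascE : ascents R 0 s = \sum_(j < n.+1) (j < n) * R (v j) (v j.+1).
  rewrite ascentsE size_s big_ord_recr /= ltnn addn0.
  by apply: eq_bigr => j _; rewrite ltn_ord mul1n.
rewrite ascE -big_split /=.
rewrite (eq_bigr (fun j : 'I_n.+1 => v j != n : nat)) => [|j _]; last exact: dE.
(* The sum now counts the slots that do not follow the unique occurrence of n. *)
have le_i : index n (0 :: s) < n.+1 := index_perm_iota_le perm_s (leqnn n).
rewrite (bigD1 (Ordinal le_i)) //= {1}/v nth_index ?(mem0_perm_iota _ perm_s) // eqxx add0n.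
rewrite (eq_bigr (fun=> 1)) => [|j neq_j].
  by rewrite sum1_card cardC1 card_ord.
apply/eqP; rewrite eqb1; apply: contra neq_j => /eqP vj; apply/eqP/val_inj.
have idx : index (v j) (0 :: s) = j.
  by rewrite index_uniq ?(uniq0_perm_iota perm_s) //= size_s.
by rewrite -[LHS]/(nat_of_ord j) -idx vj.
Qed.

(** * The Ldes statistic for a parent function, under insertion *)

Section ForestStat.
Variable par : nat -> nat.
Hypothesis par_le : forall a, par a <= a.-1.

(* The terms i past the depth of a vanish, as par 0 = 0.                       *)
Definition des (s : seq nat) a :=
  \sum_(0 <= i < a)
    (index (iter i par a) (0 :: s) < index (iter i.+1 par a) (0 :: s)).

Definition Ldes_rel s : rel nat :=
  fun a b => (des s a < des s b) || (des s a == des s b) && (b < a).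

Lemma iter_par_le a i : iter i par a <= a - i.
Proof.
by elim: i => [|i IHi] /=; [rewrite subn0 | have := par_le (iter i par a); lia].
Qed.

Lemma des0 s : des s 0 = 0. Proof. exact: big_geq. Qed.

Lemma desS s a :
  des s a.+1 = des s (par a.+1) + (index a.+1 (0 :: s) < index (par a.+1) (0 :: s)).
Proof.
rewrite /des big_nat_recl // addnC; congr (_ + _).
have le_a := par_le a.+1.
rewrite (big_cat_nat (leq0n _) le_a) /= [X in _ + X]big_nat_cond.
rewrite [X in _ + X]big1 => [|i /andP[/andP[le_i _] _]].
  by rewrite addn0; apply: eq_bigr => i _; rewrite -!iterS !iterSr.
(* Each application of [par] lowers a positive label, so the terms from [par a.+1] on compare 0 with
   itself. *)
have i0 : iter i.+1 par a.+1 = 0.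
  by apply/eqP; rewrite iterSr -leqn0 (leq_trans (iter_par_le _ _)) // leqn0 subn_eq0.
by have := par_le 0; rewrite /= in i0 *; rewrite i0 leqn0 => /eqP ->.
Qed.

Lemma index_insert n s j a : perm_eq s (iota 1 n) -> a <= n -> j <= n ->
  index a (0 :: insert n.+1 s j) = index a (0 :: s) + (j < index a (0 :: s)).
Proof.
move=> perm_s le_a le_j; case: a le_a => [|a] //= le_a.
have size_s : size s = n by rewrite (perm_size perm_s) size_iota.
have := index_cat a.+1 (take j s) (drop j s); rewrite cat_take_drop => ->.
rewrite index_cat /= size_takel ?size_s //.
have -> : (n.+1 == a.+1) = false by lia.
case: ifP => [|_]; last by lia.
by rewrite -index_mem size_takel ?size_s //; lia.
Qed.

Lemma index_insert_max n s j : perm_eq s (iota 1 n) -> j <= n ->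
  index n.+1 (0 :: insert n.+1 s j) = j.+1.
Proof.
move=> perm_s le_j; have size_s : size s = n by rewrite (perm_size perm_s) size_iota.
rewrite /= index_cat /= eqxx addn0 size_takel ?size_s //.
case: ifP => // /mem_take; rewrite (perm_mem perm_s) mem_iota; lia.
Qed.

(** Ancestors of an old label are old, and insertion preserves the relative order of old letters. *)
Lemma des_insert n s j a : perm_eq s (iota 1 n) -> a <= n -> j <= n ->
  des (insert n.+1 s j) a = des s a.
Proof.
move=> perm_s le_a le_j; apply: eq_bigr => i _.
have le_n k : iter k par a <= n by have := iter_par_le a k; lia.
by rewrite !(index_insert perm_s) //; congr (nat_of_bool _); lia.
Qed.

(** The new letter gets position j + 1, and its parent shifts by one exactly when its position
    exceeds j; hence the new letter precedes it exactly in that case. *)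
Lemma des_insert_max n s j : perm_eq s (iota 1 n) -> j <= n ->
  des (insert n.+1 s j) n.+1 =
  des s (par n.+1) + (j < index (par n.+1) (0 :: s)).
Proof.
move=> perm_s le_j; rewrite desS (index_insert_max perm_s) //.
have le_p := par_le n.+1.
rewrite (index_insert perm_s) // (des_insert perm_s) //.
by congr (_ + nat_of_bool _); lia.
Qed.

Lemma Ldes_eulerian : eulerian_stat (fun s => ascents (Ldes_rel s) 0 s).
Proof.
split=> // n s perm_s; have size_s : size s = n by rewrite (perm_size perm_s) size_iota.
set v := nth 0 (0 :: s); set p := par n.+1; set q := index p (0 :: s).
have v_le j : v j <= n := nth_perm_iota_le j perm_s.
have le_p : p <= n := par_le n.+1.
have le_q : q <= n := index_perm_iota_le perm_s le_p.
have vq : v q = p by apply: nth_index; rewrite (mem0_perm_iota _ perm_s).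
pose D j := des s p + (j < q).
(* The key (des, - label) of n.+1 inserted at j lies just below all keys with  *)
(* des = D j. So u j counts the ascents around n.+1 and e j the one destroyed. *)
pose u j := (des s (v j) < D j) + (j < n) * (D j <= des s (v j.+1)).
pose e j := (j < n) * Ldes_rel s (v j) (v j.+1).
have u_e j : (u j == e j) || (u j == (e j).+1).
  by rewrite /u /e /Ldes_rel; lia.
exists (fun j => u j != e j); split=> [j le_j|].
  have eqR : ascents (Ldes_rel (insert n.+1 s j)) 0 s = ascents (Ldes_rel s) 0 s.
    apply: eq_in_ascents => a b; rewrite !(mem0_perm_iota _ perm_s) => le_a le_b.
    by rewrite /Ldes_rel !(des_insert perm_s).
  have := @ascents_insert _ (Ldes_rel (insert n.+1 s j)) 0 n.+1 s j.
  rewrite size_s eqR => /(_ le_j); rewrite -[nth 0 s j]/(v j.+1) -/(v j).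
  rewrite /Ldes_rel (des_insert_max perm_s) // !(des_insert perm_s) // -/p -/q -/(D j).
  have := u_e j; rewrite /u /e /Ldes_rel; have := v_le j; have := v_le j.+1; lia.
have ascE : ascents (Ldes_rel s) 0 s = \sum_(j < n.+1) e j.
  rewrite ascentsE size_s big_ord_recr /= [e n]/e ltnn addn0.
  by apply: eq_bigr => j _; rewrite /e ltn_ord mul1n.
rewrite ascE -big_split /= (eq_bigr (fun j : 'I_n.+1 => u j)) => [|j _]; last first.
  by have := u_e j; lia.
(* The sum telescopes, except at the parent, where the threshold D drops.      *)
suff partial k : k <= n ->
    \sum_(j < k) u j + (des s (v k) < D k) = k + (k < q).
  by rewrite big_ord_recr /= [u n]/u ltnn addn0 partial //; lia.
elim: k => [|k IHk] lt_k.
  rewrite big_ord0 /D des0; case: (posnP q) => [q0|]; last by lia.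
  by rewrite -vq q0 des0.
rewrite big_ord_recr /= [u k]/u lt_k mul1n.
(* If [k.+1] is not [q], then D is unchanged and exactly one of D <= x and x < D holds for x =
   [des s (v k.+1)]. At [q], D drops from [des s p + 1] to [des s p] while x = [des s p], so neither
   holds, which matches the drop of [k < q]. *)
have := IHk (ltnW lt_k); move: (bigop _ _ _) => S; rewrite /D.
have [eq_q|neq_q] := eqVneq k.+1 q.
  by rewrite eq_q vq; lia.
lia.
Qed.

End ForestStat.

(** * Uniqueness of lower covers in a rooted tree *)

Section Covers.
Variables (n : nat) (r : rel 'I_n).
Hypothesis r_natural : naturally_labeled r.

Lemma cover_lt a b : cover r a b -> a < b.
Proof. by case/andP=> /r_natural. Qed.

Lemma lower_cover_exists a b : strict r a b -> exists c, cover r c b.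
Proof.
move=> lt_ab; have [c lt_cb max_c] :=
  arg_maxnP (P := fun c => strict r c b) (@nat_of_ord n) lt_ab.
exists c; apply/andP; split=> //; apply/existsPn => d.
by apply/negP => /andP[/r_natural lt_cd /max_c]; rewrite /= leqNgt lt_cd.
Qed.

(* Two lower covers a, b of c are both joined to the root below c, hence to    *)
(* each other; a simple path from a to b below c closes up into a cycle at c.  *)
Lemma rooted_tree_lower_cover_inj a b c :
  rooted_tree r -> cover r a c -> cover r b c -> a = b.
Proof.
case=> [[m [_ uniq_m]] [_ acyclic]] cov_a cov_b.
apply/eqP/negPn/negP => neq_ab.
pose e := [rel x y : 'I_n | hasse r x y && ((x < c) && (y < c))].
have conn_m k (x : 'I_n) : x < k -> x < c -> connect e m x.
  elim: k x => // k IHk x; rewrite ltnS => le_xk lt_xc.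
  have [y /lower_cover_exists[z cov_z]|min_x] := pickP (fun y => strict r y x).
    have lt_zx := cover_lt cov_z; have lt_zc := ltn_trans lt_zx lt_xc.
    apply: connect_trans (IHk z (leq_trans lt_zx le_xk) lt_zc) (connect1 _).
    by rewrite /e /= /hasse /= cov_z lt_zc lt_xc.
  by rewrite (uniq_m x) // => y; rewrite min_x.
have conn_sym : connect_sym e.
  by apply: sym_connect_sym => x y; rewrite /e /hasse /= orbC (andbC (x < c)).
have lt_ac := cover_lt cov_a; have lt_bc := cover_lt cov_b.
have : connect e a b.
  by rewrite (connect_trans _ (conn_m _ _ (ltnSn b) lt_bc)) // conn_sym (conn_m _ _ (ltnSn a)).
case/connectP=> p0 path_p0 last_p0; case/shortenP: path_p0 last_p0 => p path_p uniq_p _ last_p.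
have path_lt x : x \in p -> x < c.
  elim: p a path_p {uniq_p last_p neq_ab cov_a lt_ac} => //= y p IHp a.
  case/andP=> /andP[_ /andP[_ lt_y]] /IHp{}IHp.
  by rewrite inE => /predU1P[->|/IHp].
have notin_c : c \notin a :: p.
  rewrite inE negb_or -val_eqE /= neq_ltn lt_ac orbT /=.
  by apply/negP => /path_lt; rewrite ltnn.
apply: (acyclic (c :: a :: p)).
  (* The path has an interior or end vertex because a and b differ, so the cycle has length at least
     3. *)
  by case: p last_p {path_p path_lt uniq_p notin_c} => //= eq_ab; rewrite eq_ab eqxx in neq_ab.
apply/andP; split; last by rewrite cons_uniq notin_c.
rewrite -[path.cycle _ _]/(path (hasse r) c (rcons (a :: p) c)) rcons_path.
rewrite -[last _ _]/(last a p) -last_p.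
apply/andP; split; last by apply/orP; left.
apply/andP; split; first by apply/orP; right.
by apply: sub_path path_p => x y /andP[].
Qed.

End Covers.

Lemma adjoin_min_natural n (r : rel 'I_n) :
  naturally_labeled r -> naturally_labeled (adjoin_min r).
Proof.
move=> r_natural x y; rewrite /strict /adjoin_min /=.
case: (unliftP ord0 x) => [i ->|->]; case: (unliftP ord0 y) => [j ->|->] //.
rewrite (inj_eq lift_inj) => lt_ij.
by rewrite /= /bump !add1n ltnS r_natural.
Qed.

Lemma strict_adjoin_min_lift n (r : rel 'I_n) a b :
  strict (adjoin_min r) (lift ord0 a) (lift ord0 b) = strict r a b.
Proof. by rewrite /strict /adjoin_min /= (inj_eq lift_inj) !liftK. Qed.

Lemma strict_adjoin_min0 n (r : rel 'I_n) a :
  strict (adjoin_min r) ord0 (lift ord0 a).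
Proof. by rewrite /strict /adjoin_min /= unlift_none. Qed.

(** * From the rooted tree to the parent function and words *)

Section RootedTree.
Variables (n : nat) (r : rel 'I_n).
Hypotheses (r_natural : naturally_labeled r) (r_tree : rooted_tree r).
Let q := adjoin_min r.
Let q_natural : naturally_labeled q := adjoin_min_natural r_natural.

(** Covers between old elements come from [r]; and [ord0] cannot cover-precede an element that has
    an old lower cover, which would lie strictly between. *)
Lemma adjoin_min_lower_cover_inj x y z : cover q x z -> cover q y z -> x = y.
Proof.
have lift_cover a c : cover q (lift ord0 a) (lift ord0 c) -> cover r a c.
  rewrite /cover /= -!/(strict _ _ _) strict_adjoin_min_lift => /andP[-> /=].
  apply: contra => /existsP[b lt_abc]; apply/existsP; exists (lift ord0 b).
  by rewrite !strict_adjoin_min_lift.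
have not_cover0 b c : cover q (lift ord0 b) (lift ord0 c) -> ~~ cover q ord0 (lift ord0 c).
  case/andP=> lt_bc _; rewrite negb_and negbK; apply/orP; right.
  by apply/existsP; exists (lift ord0 b); rewrite strict_adjoin_min0.
case: (unliftP ord0 z) => [c ->|-> /(cover_lt q_natural)//].
case: (unliftP ord0 x) => [a ->|->]; case: (unliftP ord0 y) => [b ->|->] //.
- move=> /lift_cover cov_a /lift_cover cov_b.
  by rewrite (rooted_tree_lower_cover_inj r_natural r_tree cov_a cov_b).
- by move=> /not_cover0/negP.
- by move=> cov0 /not_cover0/negP.
Qed.

(** Total on [nat], as [des] requires: [inord] sends out-of-range labels to [ord0], which has no
    lower cover, so their value is 0. *)
Definition parent (b : nat) : nat :=
  if [pick x | cover q x (inord b)] is Some x then x else 0.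

Lemma parent_le b : parent b <= b.-1.
Proof.
rewrite /parent; case: pickP => // x /(cover_lt q_natural).
have [lt_b|ge_b] := ltnP b n.+1; first by rewrite inordK //; lia.
by rewrite /inord /insubd insubN -?leqNgt.
Qed.

Lemma parent_cover x y : cover q x y -> parent y = x.
Proof.
move=> cov_xy; rewrite /parent inord_val; case: pickP => [z cov_zy|/(_ x)].
  by rewrite (adjoin_min_lower_cover_inj cov_xy cov_zy).
by rewrite cov_xy.
Qed.

(** Rules out the default value 0 in [desP]. *)
Lemma sat_chain_exists a : exists p : n.-bseq 'I_n.+1, sat_chain r a p.
Proof.
suff [p chain_p] : exists p, sat_chain r a p.
  by exists (Bseq (sat_chain_size r_natural chain_p)).
have [k] := ubnP (val a); elim: k a => // k IHk a; rewrite ltnS => le_ak.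
case: (unliftP ord0 a) => [b def_a|->]; last by exists [::]; rewrite /sat_chain /=.
have [c cov_c] : exists c, cover q c a.
  by apply: (lower_cover_exists q_natural (a := ord0)); rewrite def_a strict_adjoin_min0.
have [p /andP[path_p /eqP last_p]] := IHk c (leq_trans (cover_lt q_natural cov_c) le_ak).
by exists (rcons p a); rewrite /sat_chain rcons_path path_p last_p last_rcons cov_c /=.
Qed.

Lemma chain_des_word (t : 'S_n) p : path (cover q) ord0 p ->
  chain_des t^-1 p = des parent (word t) (last ord0 p).
Proof.
elim/last_ind: p => [|p y IHp]; first by rewrite des0.
rewrite rcons_path last_rcons => /andP[/IHp des_p cov_y].
have lt_y := cover_lt q_natural cov_y.
have -> : chain_des t^-1 (rcons p y) =
    chain_des t^-1 p + (ext t^-1 y < ext t^-1 (last ord0 p)).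
  rewrite /chain_des; move: (ord0) => x.
  elim: p x {IHp des_p cov_y lt_y} => [|z p IHp] x /=; first by rewrite addn0 add0n.
  by rewrite IHp addnA.
rewrite des_p -(prednK (leq_ltn_trans (leq0n _) lt_y)) (desS parent_le).
rewrite (prednK (leq_ltn_trans (leq0n _) lt_y)) (parent_cover cov_y).
by rewrite !index_word_ext.
Qed.

Lemma desP_word (t : 'S_n) a : desP r t^-1 a = des parent (word t) a.
Proof.
rewrite /desP; case: pickP => [p /andP[path_p /eqP <-]|no_chain].
  exact: chain_des_word.
by have [p] := sat_chain_exists a; rewrite no_chain.
Qed.

Lemma DC_rooted_tree : DC r = [set: 'S_n].
Proof.
apply/setP => t; rewrite !inE; apply/forallP => a; apply/forallP => p; apply/forallP => p'.
apply/implyP => /andP[/andP[path_p /eqP last_p] /andP[path_p' /eqP last_p']].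
by rewrite -[t]invgK !chain_des_word // last_p last_p'.
Qed.

Lemma Ldes_word (t : 'S_n) : Ldes r t^-1 = ascents (Ldes_rel parent (word t)) 0 (word t).
Proof.
(* Consecutive values of [t^-1] are adjacent positions in the word, so [f] matches positions with
   the pairs (a, b) counted by [Ldes]. *)
pose f (i : 'I_n) := (ext t (widen_ord (leqnSn n) i), ext t (lift ord0 i)).
have f_inj : injective f by move=> i j [_ /perm_inj/lift_inj].
rewrite ascents_word -(card_imset _ f_inj) /Ldes; apply: eq_card => -[a b].
rewrite !inE /= !desP_word -/(Ldes_rel parent (word t) a b).
apply/andP/imsetP => [[/eqP ext_ab L_ab]|[i]].
  have lt_a : ext t^-1 a < n by rewrite -ltnS ext_ab.
  have ab : f (Ordinal lt_a) = (a, b).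
    have ext_inv x : ext t (ext t^-1 x) = x by rewrite /ext -lift_permV permKV.
    rewrite /f; congr (_, _); rewrite -[RHS]ext_inv; congr (ext t _); exact: val_inj.
  by exists (Ordinal lt_a); rewrite ?inE ?ab //; case: ab => -> ->.
rewrite inE => L_i [-> ->]; split=> //.
by rewrite /ext -lift_permV !permK.
Qed.

End RootedTree.

Theorem theorem3p9 (n : nat) (r : rel 'I_n)
    (r_order : partial_order r) (r_natural : naturally_labeled r)
    (r_tree : rooted_tree r) :
  G_Ldes r = A2 n.
Proof.
rewrite /G_Ldes /A2 (DC_rooted_tree r_natural r_tree).
(* Only the Ldes side is inverted; big ascents are read on the word of t itself. *)
rewrite (reindex_inj invg_inj) /= (eq_bigl xpredT) => [|t]; last by rewrite inE.
under eq_bigr => t _ do rewrite (Ldes_word r_natural r_tree).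
under [RHS]eq_bigr => t _ do rewrite big_ascE.
rewrite (sum_eulerian_stat _ big_asc_eulerian).
exact: (sum_eulerian_stat _ (Ldes_eulerian (parent_le r_natural))).
Qed.
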